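(* Consider the one-factor gamma model (with inverse link) with simple linear regression $\mathbf{f}(x)^{\mathsf T}\boldsymbol\beta=\beta_0+\beta_1x$, $\mathbf{f}(x)=(1,x)^{\mathsf T}$, on the experimental region $\mathcal{X}=[0,1]$, and let $\boldsymbol\beta=(\beta_0,\beta_1)^{\mathsf T}$ satisfy $\beta_0>0$ and $\beta_0+\beta_1>0$. For the $IMSE$-criterion with respect to a standardized measure $\nu$ on $[0,1]$ (that is, $\nu([0,1])=1$), locally $IMSE$-optimal designs at $\boldsymbol\beta$ can be found which are supported on the endpoints $0$ and $1$ of the experimental region. Locally optimal weights $1-w^*$ at $0$ and $w^*$ at $1$, respectively, are given by (a) $1-w^*=w^*=1/2$ for $\nu$ the uniform (Lebesgue) measure on the interval $[0,1]$; (b) $1-w^*=(\beta_0+\beta_1)/(2\beta_0+\beta_1)$ and $w^*=\beta_0/(2\beta_0+\beta_1)$ for $\nu$ the (discrete) uniform measure on the endpoints $\{0,1\}$; (c) $1-w^*=\beta_0/(2\beta_0+\beta_1)$ and $w^*=(\beta_0+\beta_1)/(2\beta_0+\beta_1)$ for $\nu$ the one-point measure on the midpoint $1/2$.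
   Context: In the gamma model with inverse link the intensity function is $\lambda(z)=\kappa/z^2$, $z>0$, with a fixed constant $\kappa>0$ (which does not affect optimality; one may take $\kappa=1$). A design $\xi$ on $[0,1]$ is given by finitely many distinct support points $x_i\in[0,1]$ and weights $w_i>0$ with $\sum_iw_i=1$. Its information matrix is $\mathbf{M}(\xi;\boldsymbol\beta)=\sum_iw_i\,\kappa(\beta_0+\beta_1x_i)^{-2}\,\mathbf{f}(x_i)\mathbf{f}(x_i)^{\mathsf T}$. With $\mathbf{V}(\boldsymbol\beta;\nu)=\int\kappa^2(\beta_0+\beta_1x)^{-4}\,\mathbf{f}(x)\mathbf{f}(x)^{\mathsf T}\,\nu(\mathrm{d}x)$, the $IMSE$-criterion is $\mathrm{IMSE}(\xi;\boldsymbol\beta,\nu)=\mathrm{trace}(\mathbf{V}(\boldsymbol\beta;\nu)\mathbf{M}(\xi;\boldsymbol\beta)^{-1})$ (for nonsingular $\mathbf{M}(\xi;\boldsymbol\beta)$). A design is locally $IMSE$-optimal at $\boldsymbol\beta$ with respect to $\nu$ if it minimizes this criterion over the designs on $[0,1]$.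
   Formalization: For a singular information matrix M the criterion is taken as trace(V M⁻) with a generalized inverse if range V lies in range M, and as +∞ otherwise; with nonsingular M only, no optimal design exists when ν is the one-point measure at 0 or at 1. *)

(* Defs.v *)
From HB Require Import structures.
From mathcomp Require Import all_boot all_order all_algebra.
From mathcomp Require Import all_classical all_reals all_analysis.

Set Implicit Arguments.
Unset Strict Implicit.
Unset Printing Implicit Defensive.

Import Order.TTheory GRing.Theory Num.Theory.
Import numFieldNormedType.Exports.

Local Open Scope classical_set_scope.
Local Open Scope ring_scope.

Section GammaModel.
Context {R : realType}.
Implicit Types (kappa b x z : R)
  (nu : {measure set (measurableTypeR R) -> \bar R}).

Definition regr x : 'cV[R]_2 := \col_i (if i == 0 then 1 else x).

Definition linpred b0 b1 x : R := b0 + b1 * x.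

(* Gamma model with inverse link; only meaningful for z > 0. *)
Definition intensity kappa z : R := kappa / z ^+ 2.

(* A design is the list of its pairs (support point, weight). *)
Definition is_design (xi : seq (R * R)) : Prop :=
  [/\ uniq (unzip1 xi),
      forall p, p \in xi -> 0 <= p.1 <= 1,
      forall p, p \in xi -> 0 < p.2
    & \sum_(p <- xi) p.2 = 1].

Definition supported_on_endpoints (xi : seq (R * R)) : Prop :=
  forall x, x \in unzip1 xi -> x = 0 \/ x = 1.

Definition endpoint_design (w : R) : seq (R * R) := [:: (0, 1 - w); (1, w)].

Definition info_mx kappa b0 b1 (xi : seq (R * R)) : 'M[R]_2 :=
  \sum_(p <- xi) (p.2 * intensity kappa (linpred b0 b1 p.1)) *:
    (regr p.1 *m (regr p.1)^T).

(* The matrix-valued integral is taken entrywise.  A measure on [0, 1] is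
   represented by a Borel measure on R, whose restriction to [0, 1] is the only
   part that matters. *)
Definition weight_mx kappa b0 b1 nu : 'M[R]_2 :=
  \matrix_(i, j) \int[nu]_(x in `[0, 1])
    (intensity kappa (linpred b0 b1 x) ^+ 2 * (regr x *m (regr x)^T) i j).

(* For a singular information matrix M the criterion takes the value usual in
   optimal design theory: trace (V M^-) for a generalized inverse M^- of M when
   the range of V is contained in that of M (the trace is then independent of
   the choice of M^-), and +oo otherwise.  Without it no optimal design exists
   when nu is a one-point measure at 0 or at 1, since the infimum over the
   designs with nonsingular M is not attained.  V and M are symmetric, so the
   inclusion of row spaces tested here is the inclusion of ranges. *)
Definition IMSE kappa b0 b1 nu (xi : seq (R * R)) : \bar R :=
  let V := weight_mx kappa b0 b1 nu in
  let M := info_mx kappa b0 b1 xi in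
  if M \in unitmx then (\tr (V *m invmx M))%:E
  else if (V <= M)%MS then (\tr (V *m pinvmx M))%:E
  else +oo%E.

Definition IMSE_optimal kappa b0 b1 nu (xi : seq (R * R)) : Prop :=
  is_design xi /\
  forall xi', is_design xi' ->
    (IMSE kappa b0 b1 nu xi <= IMSE kappa b0 b1 nu xi')%E.

Definition uniform_endpoints : {measure set (measurableTypeR R) -> \bar R} :=
  mscale (2^-1 : R)%:nng
    (measure_add (\d_(0 : measurableTypeR R)) (\d_(1 : measurableTypeR R))).

Definition uniform_unit_itv : {measure set (measurableTypeR R) -> \bar R} :=
  uniform_prob (@ltr01 R).

Definition dirac_midpoint : {measure set (measurableTypeR R) -> \bar R} :=
  \d_(2^-1 : measurableTypeR R).

End GammaModel.

(* Main.v *)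
(* With z(x) = b0 + b1 x, the vector f(x) / z(x) is the convex combination
   (1 - t) f(0) / z(0) + t f(1) / z(1) with t = x z(1) / z(x).  In the basis
   f(0) / z(0), f(1) / z(1), and up to powers of kappa, the information matrix
   therefore becomes a matrix N with nonnegative entries summing to 1, and the
   weight matrix becomes the integral U of z(x)^-2 (1 - t, t)^T (1 - t, t).
   With p^2 = U_00 and q^2 = U_11, Cauchy-Schwarz for the integral gives
   0 <= U_01 <= p q, hence tr (U N^-1) >= v^T N^-1 v with v = (p, q)^T, because
   the off-diagonal entries of N^-1 are nonpositive; and Cauchy-Schwarz for N
   gives v^T N^-1 v = (v^T N^-1 v) (e^T N e) >= (e^T v)^2 = (p + q)^2 with
   e = (1, 1)^T.  This value is attained at N = diag (1 - w, w) with
   w = q / (p + q), the matrix of the endpoint design with weight w at 1. *)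
Require Import Defs.
From HB Require Import structures.
From mathcomp Require Import all_boot all_order all_algebra.
From mathcomp Require Import all_classical all_reals all_analysis.
From mathcomp Require Import measurable_realfun ring lra.

Import Order.TTheory GRing.Theory Num.Theory.
Import numFieldNormedType.Exports.

Local Open Scope classical_set_scope.
Local Open Scope ring_scope.

(** * Entries of 2 x 2 matrices *)

Lemma ord2P (i : 'I_2) : i = 0 \/ i = 1.
Proof. by case: i => [[|[|//]] ?]; [left|right]; apply/val_inj. Qed.

Lemma mulmx2E (R : pzSemiRingType) (m n : nat) (A : 'M[R]_(m, 2))
    (B : 'M[R]_(2, n)) (i : 'I_m) (j : 'I_n) :
  (A *m B) i j = A i 0 * B 0 j + A i 1 * B 1 j.
Proof.
rewrite mxE big_ord_recl big_ord1.
by congr (_ + A i _ * B _ j); apply/val_inj.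
Qed.

Lemma mxtrace2E (R : pzSemiRingType) (A : 'M[R]_2) : \tr A = A 0 0 + A 1 1.
Proof.
rewrite /mxtrace big_ord_recl big_ord1.
by congr (_ + A _ _); apply/val_inj.
Qed.

Lemma matrix2P (T : Type) (A B : 'M[T]_2) :
  A 0 0 = B 0 0 -> A 0 1 = B 0 1 -> A 1 0 = B 1 0 -> A 1 1 = B 1 1 -> A = B.
Proof.
move=> E00 E01 E10 E11; apply/matrixP => i j.
by have [->|->] := ord2P i; have [->|->] := ord2P j.
Qed.

(** * The lower bound for the trace *)

(** Assuming only [U *m K *m N = U] treats the inverse of N and its generalized inverses together.
    For nonsingular N it gives U K = U N^-1; for singular N both matrices have rank at most one and
    the bound is an equality. *)
Lemma trace_mul_ginv_ge (R : realFieldType) (N U K : 'M[R]_2) (p q : R) :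
  U *m K *m N = U ->
  N 1 0 = N 0 1 -> N 0 0 + 2 * N 0 1 + N 1 1 = 1 ->
  0 <= N 0 1 -> N 0 1 ^+ 2 <= N 0 0 * N 1 1 ->
  U 1 0 = U 0 1 -> 0 <= p -> 0 <= q -> U 0 0 = p ^+ 2 -> U 1 1 = q ^+ 2 ->
  0 <= U 0 1 -> U 0 1 <= p * q ->
  (p + q) ^+ 2 <= \tr (U *m K).
Proof.
move=> UKN N10 N1 N01 Ndet U10 p0 q0 U00 U11 U01 U01le.
have Y00 : (U *m K *m N) 0 0 = U 0 0 by rewrite UKN.
have Y01 : (U *m K *m N) 0 1 = U 0 1 by rewrite UKN.
have Y10 : (U *m K *m N) 1 0 = U 1 0 by rewrite UKN.
have Y11 : (U *m K *m N) 1 1 = U 1 1 by rewrite UKN.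
move: Y00 Y01 Y10 Y11; rewrite mxtrace2E !mulmx2E U00 U10 U11 N10.
move: N1 N01 Ndet U01 U01le.
set a := N 0 0; set b := N 0 1; set c := N 1 1; set v := U 0 1.
set k00 := K 0 0; set k01 := K 0 1; set k10 := K 1 0; set k11 := K 1 1.
set y00 := p ^+ 2 * k00 + v * k10; set y01 := p ^+ 2 * k01 + v * k11.
set y10 := v * k00 + q ^+ 2 * k10; set y11 := v * k01 + q ^+ 2 * k11.
move=> N1 b0 Ndet v0 vle Y00 Y01 Y10 Y11.
have [D0|D0] := eqVneq (a * c - b ^+ 2) 0.
  (* N is the rank one matrix n n^T with n = (a + b, b + c), and U, which
     vanishes on the kernel of N, is the multiple l N of it. *)
  pose n0 := a + b; pose n1 := b + c.
  have n01 : n0 + n1 = 1 by rewrite -N1 /n0 /n1; ring.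
  have ac : a * c = b ^+ 2 by apply/eqP; rewrite -subr_eq0 D0.
  (* Multiplying each entry by 1 = a + 2 b + c and using a c = b^2 completes the products. *)
  have an : a = n0 ^+ 2.
    rewrite -[LHS]mulr1 -N1 !mulrDr ac /n0; ring.
  have bn : b = n0 * n1.
    rewrite -[LHS]mulr1 -N1 /n0 /n1 !(mulrDl, mulrDr) ac; ring.
  have cn : c = n1 ^+ 2.
    rewrite -[LHS]mulr1 -N1 !mulrDr [c * a]mulrC ac /n1; ring.
  (* With m = U K n, U = U K n n^T = m n^T. Symmetry of U makes m a multiple of n, and the factor is
     l = m0 + m1 because n0 + n1 = 1. *)
  pose m0 := y00 * n0 + y01 * n1; pose m1 := y10 * n0 + y11 * n1.
  pose l := m0 + m1.
  have m0n0 : m0 * n0 = p ^+ 2 by rewrite -Y00 an bn /m0; ring.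
  have m0n1 : m0 * n1 = v by rewrite -Y01 bn cn /m0; ring.
  have m1n0 : m1 * n0 = v by rewrite -Y10 an bn /m1; ring.
  have m1n1 : m1 * n1 = q ^+ 2 by rewrite -Y11 bn cn /m1; ring.
  have m0E : m0 = l * n0 by rewrite mulrDl m1n0 -m0n1 -mulrDr n01 mulr1.
  have m1E : m1 = l * n1 by rewrite mulrDl m0n1 -m1n0 -mulrDr n01 mulr1.
  have pE : p ^+ 2 = l * n0 ^+ 2 by rewrite -m0n0 m0E -mulrA.
  have vE : v = l * (n0 * n1) by rewrite -m0n1 m0E -mulrA.
  have qE : q ^+ 2 = l * n1 ^+ 2 by rewrite -m1n1 m1E -mulrA.
  (* The trace of U K is l n^T K n, while m0 + m1 is (n0 + n1) times that number. *)
  have -> : y00 + y11 = l.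
    transitivity (m0 + m1) => //; rewrite /m0 /m1.
    rewrite /y00 /y01 /y10 /y11 pE vE qE.
    transitivity ((n0 + n1) * (l * n0 ^+ 2 * k00 + l * (n0 * n1) * k10 +
       (l * (n0 * n1) * k01 + l * n1 ^+ 2 * k11))); last by ring.
    by rewrite n01 mul1r.
  have -> : l = p ^+ 2 + 2 * v + q ^+ 2.
    rewrite pE vE qE; transitivity (l * (n0 + n1) ^+ 2); last by ring.
    by rewrite n01 expr1n mulr1.
  (* Since U = l n n^T, in fact v^2 = p^2 q^2. *)
  suff : p * q <= v by nra.
  rewrite -(@ler_pXn2r _ 2) ?nnegrE ?mulr_ge0//.
  rewrite exprMn pE qE vE le_eqVlt; apply/orP; left; apply/eqP; ring.
have Dgt0 : 0 < a * c - b ^+ 2 by rewrite lt_def D0 subr_ge0.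
rewrite -(ler_pM2r Dgt0).
(* Cramer's rule for (U K) N = U gives the diagonal entries of U K. *)
have -> : (y00 + y11) * (a * c - b ^+ 2) =
    p ^+ 2 * c - 2 * v * b + q ^+ 2 * a.
  have e0 : y00 * (a * c - b ^+ 2) = p ^+ 2 * c - v * b.
    by rewrite -Y00 -Y01; ring.
  have e1 : y11 * (a * c - b ^+ 2) = q ^+ 2 * a - v * b.
    transitivity (a * (y10 * b + y11 * c) - b * (y10 * a + y11 * b)).
      by ring.
    by rewrite Y11 Y10; ring.
  by rewrite mulrDl e0 e1; ring.
(* (p, q) N^-1 (p, q)^T * (1, 1) N (1, 1)^T >= (p + q)^2, times det N *)
apply: (@le_trans _ _ (p ^+ 2 * c - 2 * (p * q) * b + q ^+ 2 * a)).
  have := sqr_ge0 (p * (b + c) - q * (a + b)).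
  have -> : (p * (b + c) - q * (a + b)) ^+ 2 =
   (p ^+ 2 * c - 2 * (p * q) * b + q ^+ 2 * a) * (a + 2 * b + c) -
     (p + q) ^+ 2 * (a * c - b ^+ 2) by ring.
  by rewrite N1 mulr1 subr_ge0.
(* Replacing v by p q lowers the expression because b >= 0. *)
by rewrite lerD2r lerD2l lerN2 -!mulrA ler_pM2l // mulrA ler_wpM2r.
Qed.

(** * Attainment of the bound at a diagonal matrix *)

Section DiagonalDivisor.
Variables (R : realFieldType) (N U : 'M[R]_2) (r w : R).
Hypotheses (N00 : N 0 0 = 1 - w) (N01 : N 0 1 = 0) (N10 : N 1 0 = 0)
  (N11 : N 1 1 = w) (U00 : U 0 0 = (r * (1 - w)) ^+ 2)
  (U11 : U 1 1 = (r * w) ^+ 2) (U10 : U 1 0 = U 0 1)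
  (U01 : (w == 0) || (w == 1) -> U 0 1 = 0).

(** Gives the inclusion of row spaces even for singular N. For w = 0 or w = 1, U is r^2 N; otherwise
    the columns of U are divided by the diagonal of N. *)
Lemma diag_mulmx_left : exists X, U = X *m N.
Proof.
have [w01|] := boolP ((w == 0) || (w == 1)).
  exists (r ^+ 2)%:M; apply: matrix2P; rewrite mul_scalar_mx mxE.
  - by rewrite U00 N00; case/orP: w01 => /eqP ->; ring.
  - by rewrite U01// N01 mulr0.
  - by rewrite U10 U01// N10 mulr0.
  - by rewrite U11 N11; case/orP: w01 => /eqP ->; ring.
rewrite negb_or => /andP[w_neq0 w_neq1].
have w1_neq0 : 1 - w != 0 by rewrite subr_eq0 eq_sym.
exists (\matrix_(i, j) (U i j / (if j == 0 then 1 - w else w))).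
by apply: matrix2P; rewrite mulmx2E !mxE /= ?N00 ?N01 ?N10 ?N11
  mulr0 ?addr0 ?add0r divfK.
Qed.

Lemma diag_mulmx_left_trace (L : 'M[R]_2) :
  U *m L *m N = U -> \tr (U *m L) = r ^+ 2.
Proof.
move=> ULN; rewrite mxtrace2E.
have Y0 : (U *m L) 0 0 * (1 - w) = (r * (1 - w)) ^+ 2.
  by rewrite -U00 -[in RHS]ULN [RHS]mulmx2E N00 N10 mulr0 addr0.
have Y1 : (U *m L) 1 1 * w = (r * w) ^+ 2.
  by rewrite -U11 -[in RHS]ULN [RHS]mulmx2E N11 N01 mulr0 add0r.
(* At w = 0 only [U 0 0] can be nonzero, so row 1 of U L vanishes and [Y0] alone gives the trace; w
   = 1 is the mirror image. *)
have [w_eq0|w_neq0] := eqVneq w 0.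
  rewrite [X in _ + X]mulmx2E U10 U01 ?w_eq0 ?eqxx//.
  move: Y0; rewrite U11 w_eq0 subr0 !mulr1 => ->.
  by rewrite mulr0 expr0n /= !mul0r !addr0.
have [w_eq1|w_neq1] := eqVneq w 1.
  rewrite [X in X + _]mulmx2E U01 ?w_eq1 ?eqxx ?orbT//.
  move: Y1; rewrite U00 w_eq1 subrr !mulr1 => ->.
  by rewrite mulr0 expr0n /= !mul0r !add0r.
have w1_neq0 : 1 - w != 0 by rewrite subr_eq0 eq_sym.
have -> : (U *m L) 0 0 = r ^+ 2 * (1 - w).
  by apply: (mulIf w1_neq0); rewrite Y0; ring.
have -> : (U *m L) 1 1 = r ^+ 2 * w.
  by apply: (mulIf w_neq0); rewrite Y1; ring.
by rewrite -mulrDr subrK mulr1.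
Qed.

End DiagonalDivisor.

(** * Integration by antiderivatives and positive quadratic forms *)

(** A derivative at every point of the closed interval supplies both the interior derivability and
    the one-sided limits required by [continuous_FTC2]. *)
Lemma continuous_FTC2_derive (R : realType) (f F : R -> R) (a b : R) : a < b ->
  {within `[a, b], continuous f} ->
  (forall x, x \in `[a, b] -> is_derive x 1 F (f x)) ->
  (\int[lebesgue_measure]_(x in `[a, b]) (f x)%:E)%E = (F b - F a)%:E.
Proof.
move=> ab cf dF.
have cF x : x \in `[a, b] -> F z @[z --> x] --> F x.
  by move=> /dF[dFx _]; exact/differentiable_continuous/derivable1_diffP.
rewrite (continuous_FTC2 ab cf (F := F)) ?EFinB//.
  split.
  - by move=> x xab; case: (dF x (subset_itv_oo_cc xab)).
  - by apply/cvg_at_right_filter/cF; rewrite in_itv/= lexx ltW.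
  - by apply/cvg_at_left_filter/cF; rewrite in_itv/= lexx ltW.
move=> x xab; rewrite derive1E; by case: (dF x (subset_itv_oo_cc xab)).
Qed.

(** The common core of the Cauchy-Schwarz inequalities for a design and for an integral. *)
Lemma sqr_le_of_quadratic_ge0 (R : realFieldType) (u v s : R) :
  (forall x y, 0 <= x ^+ 2 * u + 2 * (x * y) * v + y ^+ 2 * s) ->
  v ^+ 2 <= u * s.
Proof.
move=> Q.
have u0 : 0 <= u by have := Q 1 0; lra.
have s0 : 0 <= s by have := Q 0 1; lra.
have [us0|us_gt0] := eqVneq (u + s) 0.
  have -> : u = 0 by lra.
  (* With u = s = 0 the form takes the value -2 v^2 at (1, -v). *)
  by have := Q 1 (- v); nra.
have {}us_gt0 : 0 < u + s by rewrite lt_def us_gt0 addr_ge0.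
rewrite -subr_ge0 -(pmulr_lge0 _ us_gt0).
(* The two values are s (u s - v^2) and u (u s - v^2), and their sum is the goal. *)
have := Q s (- v); have := Q (- v) u; nra.
Qed.

(** * Coordinates with respect to the endpoints *)

Section EndpointCoordinates.
Context {R : realType}.
Variables kappa b0 b1 : R.
Implicit Types (x w : R) (xi : seq (R * R)) (i j : 'I_2)
  (nu : {measure set (measurableTypeR R) -> \bar R}).

Definition endpoint_frac x : R := x * (b0 + b1) / linpred b0 b1 x.

Definition endpoint_coord x i : R :=
  if i == 0 then 1 - endpoint_frac x else endpoint_frac x.

(** The columns are f(0) / z(0) and f(1) / z(1). *)
Definition endpoint_basis : 'M[R]_2 :=
  \matrix_(i, j) (if j == 0 then (i == 0)%:R / b0 else (b0 + b1)^-1).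

Definition coord_mx xi : 'M[R]_2 :=
  \matrix_(i, j)
    \sum_(p <- xi) p.2 * (endpoint_coord p.1 i * endpoint_coord p.1 j).

(** The intensity enters the weight matrix squared, so z^-2 survives the normalization of f by z. *)
Definition coord_weight_mx nu : 'M[R]_2 :=
  \matrix_(i, j) \int[nu]_(x in `[0, 1])
    (linpred b0 b1 x ^- 2 * (endpoint_coord x i * endpoint_coord x j)).

Hypotheses (kappa_gt0 : 0 < kappa) (b0_gt0 : 0 < b0) (b01_gt0 : 0 < b0 + b1).

Lemma linpred_gt0 x : 0 <= x <= 1 -> 0 < linpred b0 b1 x.
Proof.
rewrite /linpred => /andP[x0 x1].
have -> : b0 + b1 * x = (1 - x) * b0 + x * (b0 + b1) by ring.
have [->|x_neq0] := eqVneq x 0; first by rewrite mul0r addr0 subr0 mul1r.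
by rewrite ltr_wpDl ?mulr_ge0 ?mulr_gt0 ?subr_ge0 ?(ltW b0_gt0)// lt_def x_neq0.
Qed.

Lemma endpoint_coord_ge0 x i : 0 <= x <= 1 -> 0 <= endpoint_coord x i.
Proof.
move=> x01; have z_gt0 := linpred_gt0 x x01; have /andP[x0 x1] := x01.
rewrite /endpoint_coord /endpoint_frac; case: ifP => _.
  rewrite subr_ge0 ler_pdivrMr// mul1r /linpred -subr_ge0.
  have -> : b0 + b1 * x - x * (b0 + b1) = (1 - x) * b0 by ring.
  by rewrite mulr_ge0 ?subr_ge0// ltW.
by rewrite divr_ge0 ?mulr_ge0// ltW.
Qed.

Lemma regr_coord x i : 0 <= x <= 1 ->
  regr x i 0 = linpred b0 b1 x *
    (endpoint_basis i 0 * endpoint_coord x 0 +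
     endpoint_basis i 1 * endpoint_coord x 1).
Proof.
move=> /linpred_gt0/lt0r_neq0 z_neq0.
have b0_neq0 := lt0r_neq0 b0_gt0; have b01_neq0 := lt0r_neq0 b01_gt0.
rewrite !mxE /endpoint_coord /endpoint_frac /=.
have [->|->] := ord2P i; rewrite /=; move: z_neq0; rewrite /linpred => z_neq0;
  by field; rewrite ?z_neq0 ?b0_neq0 ?b01_neq0.
Qed.

Lemma endpoint_basis_unit : endpoint_basis \in unitmx.
Proof.
have b0_neq0 := lt0r_neq0 b0_gt0; have b01_neq0 := lt0r_neq0 b01_gt0.
(* [H] is the inverse; it sends f(x) to (b0 (1 - x), (b0 + b1) x). *)
pose H : 'M[R]_2 := \matrix_(i, j)
  (if i == 0 then (if j == 0 then b0 else - b0) else (j != 0)%:R * (b0 + b1)).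
apply: (proj1 (@mulmx1_unit _ _ _ H _)).
by apply: matrix2P; rewrite !mulmx2E !mxE /=; field; rewrite ?b0_neq0 ?b01_neq0.
Qed.

Lemma mulmx_sandwich2E (G N : 'M[R]_2) i j :
  (G *m N *m G^T) i j =
  G i 0 * G j 0 * N 0 0 + G i 0 * G j 1 * N 0 1 +
  G i 1 * G j 0 * N 1 0 + G i 1 * G j 1 * N 1 1.
Proof. by rewrite !mulmx2E ![G^T _ _]mxE; ring. Qed.

(** The factor z^2 coming from f f^T cancels the denominator of the intensity. *)
Lemma info_mx_coord xi : is_design xi ->
  info_mx kappa b0 b1 xi =
  kappa *: (endpoint_basis *m coord_mx xi *m endpoint_basis^T).
Proof.
move=> [_ xi01 _ _]; apply/matrixP => i j.
rewrite [RHS]mxE mulmx_sandwich2E ![coord_mx _ _ _]mxE summxE.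
rewrite !big_distrr -!big_split big_distrr /=.
apply: eq_big_seq => p /xi01 p01.
rewrite mxE [X in _ * X]mxE big_ord1 [_^T _ _]mxE !regr_coord// /intensity.
have z_neq0 := lt0r_neq0 (linpred_gt0 _ p01).
by field; rewrite z_neq0.
Qed.

Lemma coord_mx_sym xi : coord_mx xi 1 0 = coord_mx xi 0 1.
Proof.
by rewrite !mxE; apply: eq_bigr => p _;
  rewrite [in RHS](mulrC (endpoint_coord _ _)).
Qed.

(** The two coordinates of each point sum to 1, so the quadratic form at (1, 1) is the total
    weight. *)
Lemma coord_mx_sum1 xi : is_design xi ->
  coord_mx xi 0 0 + 2 * coord_mx xi 0 1 + coord_mx xi 1 1 = 1.
Proof.
move=> [_ _ _ w1]; rewrite -[RHS]w1 !mxE big_distrr -!big_split /=.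
by apply: eq_bigr => p _; rewrite /endpoint_coord/=; ring.
Qed.

Lemma coord_mx01_ge0 xi : is_design xi -> 0 <= coord_mx xi 0 1.
Proof.
move=> [_ xi01 xi_gt0 _]; rewrite mxE big_seq; apply: sumr_ge0 => p pxi.
apply: mulr_ge0; first exact/ltW/xi_gt0.
by apply: mulr_ge0; apply: endpoint_coord_ge0; exact: xi01.
Qed.

Lemma coord_mx_det xi : is_design xi ->
  coord_mx xi 0 1 ^+ 2 <= coord_mx xi 0 0 * coord_mx xi 1 1.
Proof.
move=> [_ _ xi_gt0 _]; apply: sqr_le_of_quadratic_ge0 => x y.
rewrite !mxE !big_distrr -!big_split big_seq /=; apply: sumr_ge0 => p pxi.
have /ltW := xi_gt0 p pxi.
set c0 := endpoint_coord _ 0; set c1 := endpoint_coord _ 1 => w0.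
have -> : x ^+ 2 * (p.2 * (c0 * c0)) + 2 * (x * y) * (p.2 * (c0 * c1)) +
  y ^+ 2 * (p.2 * (c1 * c1)) = p.2 * (x * c0 + y * c1) ^+ 2 by ring.
by rewrite mulr_ge0// sqr_ge0.
Qed.

(** * Generalized inverses and the change of basis *)

(** Reduces the case distinction in [IMSE] to one equation, valid for the inverse and for the
    pseudoinverse. *)
Lemma IMSE_pinfty_or_ginv nu xi :
  IMSE kappa b0 b1 nu xi = +oo%E \/
  exists K, weight_mx kappa b0 b1 nu *m K *m info_mx kappa b0 b1 xi =
            weight_mx kappa b0 b1 nu /\
    IMSE kappa b0 b1 nu xi = (\tr (weight_mx kappa b0 b1 nu *m K))%:E.
Proof.
rewrite /IMSE; case: ifPn => [M_unit|_].
  by right; exists (invmx (info_mx kappa b0 b1 xi)); rewrite mulmxKV.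
case: ifPn => [VM|_]; last by left.
by right; exists (pinvmx (info_mx kappa b0 b1 xi)); rewrite mulmxKpV.
Qed.

Lemma IMSE_ginv nu xi :
  (weight_mx kappa b0 b1 nu <= info_mx kappa b0 b1 xi)%MS ->
  exists K, weight_mx kappa b0 b1 nu *m K *m info_mx kappa b0 b1 xi =
            weight_mx kappa b0 b1 nu /\
    IMSE kappa b0 b1 nu xi = (\tr (weight_mx kappa b0 b1 nu *m K))%:E.
Proof.
move=> VM; case: (IMSE_pinfty_or_ginv nu xi) => //.
by rewrite /IMSE VM; case: ifP.
Qed.

(** Take L = kappa G^T K G and cancel the invertible G and G^T. The factor kappa^2 of V, less the
    kappa absorbed in L, leaves one kappa before the trace. *)
Lemma ginv_endpoint_coord (N U K : 'M[R]_2) (G := endpoint_basis)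
    (V := kappa ^+ 2 *: (G *m U *m G^T)) (M := kappa *: (G *m N *m G^T)) :
  V *m K *m M = V ->
  exists2 L, U *m L *m N = U & \tr (V *m K) = kappa * \tr (U *m L).
Proof.
have G_unit := endpoint_basis_unit; have k_neq0 := lt0r_neq0 kappa_gt0.
have GT_unit : G^T \in unitmx by rewrite unitmx_tr.
move=> VKM; exists (kappa *: (G^T *m K *m G)).
  have : V *m K *m M = kappa ^+ 2 *:
      (G *m (U *m (kappa *: (G^T *m K *m G)) *m N) *m G^T).
    rewrite /V /M -?scalemxAr -?scalemxAl -?scalemxAr -?scalemxAl !scalerA.
    by rewrite [kappa * _]mulrC !mulmxA.
  rewrite VKM => /(scalerI (expf_neq0 _ k_neq0)).
  move=> /(can_inj (mulmxK GT_unit)) /(can_inj (mulKmx G_unit)).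
  by [].
rewrite -scalemxAr -scalemxAl !mxtraceZ mulrA -expr2; congr (_ * _).
by rewrite -!mulmxA mxtrace_mulC !mulmxA.
Qed.

(** * Integrals of the weight density *)

Definition coord_density i j x : R :=
  linpred b0 b1 x ^- 2 * (endpoint_coord x i * endpoint_coord x j).

Lemma coord_weight_mxE nu i j :
  coord_weight_mx nu i j = \int[nu]_(x in `[0, 1]) coord_density i j x.
Proof. by rewrite mxE. Qed.

Lemma coord_density_ge0 i j x : x \in `[0, 1] -> 0 <= coord_density i j x.
Proof.
rewrite in_itv/= => x01; rewrite /coord_density mulr_ge0//.
  by rewrite invr_ge0 exprn_ge0// ltW//; exact: linpred_gt0.
by apply: mulr_ge0; exact: endpoint_coord_ge0.
Qed.

Lemma continuous_linpred : continuous (linpred b0 b1).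
Proof.
by move=> x; apply: cvgD; [exact: cvg_cst|apply: cvgMr; exact: cvg_id].
Qed.

Lemma within_continuous_coord_density i j :
  {within `[0, 1], continuous (coord_density i j)}.
Proof.
apply: continuous_in_subspaceT => x; rewrite inE/= in_itv/= => x01.
have z_neq0 := lt0r_neq0 (linpred_gt0 _ x01).
have cz := continuous_linpred x.
have ct : {for x, continuous endpoint_frac}.
  by apply: cvgM; [apply: cvgM; [exact: cvg_id|exact: cvg_cst]|exact: cvgV].
have cc k : {for x, continuous (endpoint_coord ^~ k)}.
  rewrite /endpoint_coord; case: (k == 0) => //.
  by apply: cvgB => //; exact: cvg_cst.
apply: cvgM; last by apply: cvgM; exact: cc.
by apply: cvgV; [rewrite expf_neq0|apply: cvgM].
Qed.

Lemma measurable_coord_density i j :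
  measurable_fun (`[0, 1] : set (measurableTypeR R)) (coord_density i j).
Proof.
apply: subspace_continuous_measurable_fun => //.
exact: within_continuous_coord_density.
Qed.

Lemma integrable_coord_density nu i j : (nu `[0%R, 1%R]%classic < +oo)%E ->
  nu.-integrable `[0, 1] (EFin \o coord_density i j).
Proof.
move=> nu_fin; apply: measurable_bounded_integrable => //.
  exact: measurable_coord_density.
have /compact_bounded[M [_ mrt]] := continuous_compact
  (within_continuous_coord_density i j) (@segment_compact R 0 1).
by exists M; split; rewrite ?num_real // => ? ? ? ?; exact: mrt.
Qed.

(** Arbitrary coefficients serve both the change of basis of the weight matrix and its quadratic
    form. *)
Lemma integrable_lin_coord_density nu (a : 'I_2 -> 'I_2 -> R) :
  (nu `[0%R, 1%R]%classic < +oo)%E ->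
  nu.-integrable `[0, 1] (EFin \o (fun x =>
    a 0 0 * coord_density 0 0 x + a 0 1 * coord_density 0 1 x +
    a 1 0 * coord_density 1 0 x + a 1 1 * coord_density 1 1 x)) /\
  \int[nu]_(x in `[0, 1]) (a 0 0 * coord_density 0 0 x +
    a 0 1 * coord_density 0 1 x + a 1 0 * coord_density 1 0 x +
    a 1 1 * coord_density 1 1 x) =
  a 0 0 * coord_weight_mx nu 0 0 + a 0 1 * coord_weight_mx nu 0 1 +
  a 1 0 * coord_weight_mx nu 1 0 + a 1 1 * coord_weight_mx nu 1 1.
Proof.
move=> nu_fin; have mI : measurable (`[0, 1] : set (measurableTypeR R)) by [].
have id i j := integrable_coord_density nu i j nu_fin.
have ia i j : nu.-integrable `[0, 1]
    (EFin \o (fun x => a i j * coord_density i j x)).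
  exact: (integrableZl mI (a i j) (id i j)).
have iD (f g : R -> R) : nu.-integrable `[0, 1] (EFin \o f) ->
    nu.-integrable `[0, 1] (EFin \o g) ->
    nu.-integrable `[0, 1] (EFin \o (fun x => f x + g x)).
  by move=> fi gi; exact: (integrableD mI fi gi).
have iD2 := iD _ _ (ia 0 0) (ia 0 1); have iD3 := iD _ _ iD2 (ia 1 0).
split; first exact: iD _ _ iD3 (ia 1 1).
by rewrite !coord_weight_mxE !RintegralD// !RintegralZl.
Qed.

Lemma weight_mx_coord nu : (nu `[0%R, 1%R]%classic < +oo)%E ->
  weight_mx kappa b0 b1 nu =
  kappa ^+ 2 *: (endpoint_basis *m coord_weight_mx nu *m endpoint_basis^T).
Proof.
move=> nu_fin; apply/matrixP => i j; rewrite mxE [RHS]mxE mulmx_sandwich2E.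
pose G := endpoint_basis.
have [ilin <-] := integrable_lin_coord_density nu
  (fun k l => G i k * G j l) nu_fin.
rewrite -RintegralZl//; apply: eq_Rintegral => x.
rewrite inE/= in_itv/= => x01.
have z_neq0 := lt0r_neq0 (linpred_gt0 _ x01).
rewrite mxE big_ord1 [_^T _ _]mxE !regr_coord// /intensity /coord_density -/G.
by field; rewrite z_neq0.
Qed.

Lemma coord_weight_mx_sym nu :
  coord_weight_mx nu 1 0 = coord_weight_mx nu 0 1.
Proof.
rewrite !coord_weight_mxE; apply: eq_Rintegral => x _.
by rewrite /coord_density (mulrC (endpoint_coord x 1)).
Qed.

Lemma coord_weight_mx_ge0 nu i j : 0 <= coord_weight_mx nu i j.
Proof.
rewrite coord_weight_mxE; apply: Rintegral_ge0 => x.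
exact: coord_density_ge0.
Qed.

Lemma coord_weight_mx_det nu : (nu `[0%R, 1%R]%classic < +oo)%E ->
  coord_weight_mx nu 0 1 ^+ 2 <=
  coord_weight_mx nu 0 0 * coord_weight_mx nu 1 1.
Proof.
move=> nu_fin; apply: sqr_le_of_quadratic_ge0 => a b.
have [_] := integrable_lin_coord_density nu
  (fun i j => (if i == 0 then a else b) * (if j == 0 then a else b)) nu_fin.
rewrite /= coord_weight_mx_sym => lin4.
(* The form at (a, b) is the integral of z^-2 (a (1 - t) + b t)^2. *)
rewrite (_ : _ + _ = \int[nu]_(x in `[0, 1])
    (linpred b0 b1 x ^- 2 *
     (a * endpoint_coord x 0 + b * endpoint_coord x 1) ^+ 2)).
  apply: Rintegral_ge0 => x /=; rewrite in_itv/= => /linpred_gt0 z_gt0.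
  by rewrite mulr_ge0 ?sqr_ge0// invr_ge0 sqr_ge0.
transitivity (a * a * coord_weight_mx nu 0 0 + a * b * coord_weight_mx nu 0 1 +
  b * a * coord_weight_mx nu 0 1 + b * b * coord_weight_mx nu 1 1).
  by ring.
rewrite -lin4; apply: eq_Rintegral => x _; rewrite /coord_density; ring.
Qed.

Lemma coord_weight_mx01_le nu p q : (nu `[0%R, 1%R]%classic < +oo)%E ->
  0 <= p -> 0 <= q ->
  coord_weight_mx nu 0 0 = p ^+ 2 -> coord_weight_mx nu 1 1 = q ^+ 2 ->
  coord_weight_mx nu 0 1 <= p * q.
Proof.
move=> nu_fin p0 q0 U00 U11.
rewrite -(@ler_pXn2r _ 2) ?nnegrE ?mulr_ge0 ?coord_weight_mx_ge0//.
by rewrite exprMn -U00 -U11 coord_weight_mx_det.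
Qed.

(** * The bound for the criterion and designs attaining it *)

Lemma IMSE_ge nu xi p q : (nu `[0%R, 1%R]%classic < +oo)%E ->
  is_design xi -> 0 <= p -> 0 <= q ->
  coord_weight_mx nu 0 0 = p ^+ 2 -> coord_weight_mx nu 1 1 = q ^+ 2 ->
  ((kappa * (p + q) ^+ 2)%:E <= IMSE kappa b0 b1 nu xi)%E.
Proof.
move=> nu_fin dxi p0 q0 U00 U11.
have [->|[K [VKM ->]]] := IMSE_pinfty_or_ginv nu xi; first by rewrite leey.
move: VKM; rewrite weight_mx_coord// info_mx_coord//.
move=> /ginv_endpoint_coord[L ULN ->].
rewrite lee_fin ler_pM2l//; apply: (trace_mul_ginv_ge _ _ _ _ _ _ ULN) => //.
- exact: coord_mx_sym.
- exact: coord_mx_sum1.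
- exact: coord_mx01_ge0.
- exact: coord_mx_det.
- exact: coord_weight_mx_sym.
- exact: coord_weight_mx_ge0.
- exact: coord_weight_mx01_le.
Qed.

(** With p = r (1 - w) and q = r w one has p + q = r, so the lower bound is kappa r^2, the value at
    N = diag (1 - w, w). Parametrizing by r and w avoids dividing by p + q and includes w = 0 and w
    = 1. *)
Lemma IMSE_optimal_of_diag nu xi r w : (nu `[0%R, 1%R]%classic < +oo)%E ->
  is_design xi -> 0 <= r -> 0 <= w <= 1 ->
  coord_mx xi 0 0 = 1 - w -> coord_mx xi 0 1 = 0 -> coord_mx xi 1 1 = w ->
  coord_weight_mx nu 0 0 = (r * (1 - w)) ^+ 2 ->
  coord_weight_mx nu 1 1 = (r * w) ^+ 2 ->
  IMSE_optimal kappa b0 b1 nu xi.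
Proof.
move=> nu_fin dxi r0 /andP[w0 w1] N00 N01 N11 U00 U11; split=> // xi' dxi'.
have p0 : 0 <= r * (1 - w) by rewrite mulr_ge0 ?subr_ge0.
have q0 : 0 <= r * w by rewrite mulr_ge0.
apply: le_trans (IMSE_ge _ _ _ _ nu_fin dxi' p0 q0 U00 U11).
have U01le := coord_weight_mx01_le _ _ _ nu_fin p0 q0 U00 U11.
(* At the extreme weights p q = 0, which squeezes the off-diagonal entry to 0. *)
have U01_0 : (w == 0) || (w == 1) -> coord_weight_mx nu 0 1 = 0.
  move=> w01; apply/eqP; rewrite eq_le coord_weight_mx_ge0 andbT.
  apply: le_trans U01le _.
  by case/orP: w01 => /eqP ->; rewrite ?subrr !(mulr0, mul0r).
have N10 : coord_mx xi 1 0 = 0 by rewrite coord_mx_sym.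
have U10 := coord_weight_mx_sym nu.
have VM : (weight_mx kappa b0 b1 nu <= info_mx kappa b0 b1 xi)%MS.
  rewrite weight_mx_coord// info_mx_coord//.
  pose G := endpoint_basis.
  have [X ->] := diag_mulmx_left _ _ _ _ _ N00 N01 N10 N11 U00 U11 U10 U01_0.
  (* If U = X N, then V = (kappa G X G^-1) (kappa G N G^T). *)
  apply/submxP; exists (kappa *: (G *m X *m invmx G)).
  rewrite -scalemxAl -scalemxAr scalerA -expr2; congr (_ *: _).
  by rewrite !mulmxA mulmxKV ?endpoint_basis_unit.
have [K [+ ->]] := IMSE_ginv nu xi VM.
rewrite weight_mx_coord// info_mx_coord//.
move=> /ginv_endpoint_coord[L ULN ->].
by rewrite (diag_mulmx_left_trace _ _ _ _ _ N00 N01 N10 N11 U00 U11 U10 U01_0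
  _ ULN) -mulrDr subrK mulr1.
Qed.

Lemma endpoint_coordE :
  (endpoint_coord 0 0 = 1) * (endpoint_coord 0 1 = 0) *
  (endpoint_coord 1 0 = 0) * (endpoint_coord 1 1 = 1).
Proof.
rewrite /endpoint_coord /endpoint_frac /linpred /= mulr1.
by rewrite !mul0r subr0 mul1r divff ?lt0r_neq0// subrr.
Qed.

Lemma endpoint_design_is_design w : 0 < w < 1 -> is_design (endpoint_design w).
Proof.
move=> /andP[w0 w1]; split.
- by rewrite /= inE eq_sym oner_eq0.
- by move=> p; rewrite !inE => /orP[]/eqP-> /=; rewrite ?lexx ?ler01.
- by move=> p; rewrite !inE => /orP[]/eqP-> /=; rewrite ?subr_gt0.
- by rewrite !big_cons big_nil /= addr0 subrK.
Qed.

(** The condition on w is the squared form of w : (1 - w) = q : p, so concrete measures need no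
    square roots. *)
Lemma endpoint_design_optimal nu w : (nu `[0%R, 1%R]%classic < +oo)%E ->
  0 < w < 1 ->
  coord_weight_mx nu 0 0 * w ^+ 2 = coord_weight_mx nu 1 1 * (1 - w) ^+ 2 ->
  IMSE_optimal kappa b0 b1 nu (endpoint_design w).
Proof.
move=> nu_fin w01 Uw; have /andP[w0 w1] := w01.
have w_neq0 := lt0r_neq0 w0.
have U11_ge0 : 0 <= coord_weight_mx nu 1 1 by exact: coord_weight_mx_ge0.
(* This is p + q, written so that r w = q. *)
pose r := Num.sqrt (coord_weight_mx nu 1 1) / w.
apply: (IMSE_optimal_of_diag _ _ r w) => //.
- exact: endpoint_design_is_design.
- by rewrite /r divr_ge0 ?sqrtr_ge0// ltW.
- by rewrite !ltW.
- by rewrite mxE !big_cons big_nil /= !endpoint_coordE; ring.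
- by rewrite mxE !big_cons big_nil /= !endpoint_coordE; ring.
- by rewrite mxE !big_cons big_nil /= !endpoint_coordE; ring.
- apply: (mulIf (expf_neq0 2 w_neq0)); rewrite Uw /r -{1}(sqr_sqrtr U11_ge0).
  by field.
- by rewrite /r divfK// sqr_sqrtr.
Qed.

Lemma point_design_is_design x : 0 <= x <= 1 -> is_design [:: (x, 1)].
Proof.
by move=> x01; split=> //= [p|p|]; rewrite ?inE ?big_seq1// => /eqP -> /=.
Qed.

Lemma exists_endpoint_optimal nu : (nu `[0%R, 1%R]%classic < +oo)%E ->
  exists xi, supported_on_endpoints xi /\ IMSE_optimal kappa b0 b1 nu xi.
Proof.
move=> nu_fin.
have U00_ge0 := coord_weight_mx_ge0 nu 0 0.
have U11_ge0 := coord_weight_mx_ge0 nu 1 1.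
set p := Num.sqrt (coord_weight_mx nu 0 0).
set q := Num.sqrt (coord_weight_mx nu 1 1).
have pU : coord_weight_mx nu 0 0 = p ^+ 2 by rewrite sqr_sqrtr.
have qU : coord_weight_mx nu 1 1 = q ^+ 2 by rewrite sqr_sqrtr.
have p_ge0 : 0 <= p by rewrite sqrtr_ge0.
have q_ge0 : 0 <= q by rewrite sqrtr_ge0.
(* If q = 0 or p = 0, the weight at one endpoint would be 0, which a design excludes; the one-point
   design at the other endpoint is used. *)
have [q0|q_neq0] := eqVneq q 0.
  exists [:: (0, 1)]; split; first by move=> x; rewrite inE => /eqP; left.
  apply: (IMSE_optimal_of_diag _ _ p 0) => //.
  - by apply: point_design_is_design; rewrite lexx ler01.
  - by rewrite lexx ler01.
  - by rewrite mxE big_seq1 /= !endpoint_coordE; ring.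
  - by rewrite mxE big_seq1 /= !endpoint_coordE; ring.
  - by rewrite mxE big_seq1 /= !endpoint_coordE; ring.
  - by rewrite pU subr0 mulr1.
  - by rewrite qU q0 mulr0.
have [p0|p_neq0] := eqVneq p 0.
  exists [:: (1, 1)]; split; first by move=> x; rewrite inE => /eqP; right.
  apply: (IMSE_optimal_of_diag _ _ q 1) => //.
  - by apply: point_design_is_design; rewrite lexx ler01.
  - by rewrite lexx ler01.
  - by rewrite mxE big_seq1 /= !endpoint_coordE; ring.
  - by rewrite mxE big_seq1 /= !endpoint_coordE; ring.
  - by rewrite mxE big_seq1 /= !endpoint_coordE; ring.
  - by rewrite pU p0 subrr mulr0.
  - by rewrite qU mulr1.
have p_gt0 : 0 < p by rewrite lt_def p_neq0.
have q_gt0 : 0 < q by rewrite lt_def q_neq0.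
exists (endpoint_design (q / (p + q))); split.
  by move=> x; rewrite !inE => /orP[]/eqP; [left|right].
have pq_neq0 : p + q != 0 by rewrite lt0r_neq0// addr_gt0.
apply: endpoint_design_optimal => //.
  by rewrite divr_gt0 ?addr_gt0// ltr_pdivrMr ?addr_gt0// mul1r ltrDr.
by rewrite pU qU; field.
Qed.

(** * Weight matrices of the three special measures *)

Lemma coord_weight_mx_dirac_midpoint i j :
  coord_weight_mx dirac_midpoint i j = coord_density i j 2^-1.
Proof.
rewrite coord_weight_mxE /Rintegral integral_dirac//.
  by rewrite diracE mem_set ?mul1e//= in_itv/=; apply/andP; split; lra.
by apply/measurable_EFinP; exact: measurable_coord_density.
Qed.

Lemma coord_weight_mx_uniform_endpoints i j :
  coord_weight_mx uniform_endpoints i j =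
  2^-1 * (coord_density i j 0 + coord_density i j 1).
Proof.
have m : measurable_fun (`[0, 1] : set (measurableTypeR R))
    (EFin \o coord_density i j).
  by apply/measurable_EFinP; exact: measurable_coord_density.
have d_ge0 x : `[0, 1]%classic x -> (0 <= (coord_density i j x)%:E)%E.
  by rewrite lee_fin; exact: coord_density_ge0.
rewrite coord_weight_mxE /Rintegral ge0_integral_mscale//.
rewrite ge0_integral_measure_add// !integral_dirac// !diracE !mem_set/=.
- by rewrite !mul1r.
- by rewrite in_itv/= lexx ler01.
- by rewrite in_itv/= lexx ler01.
Qed.

Lemma coord_weight_mx_uniform_unit_itv i j :
  (coord_weight_mx uniform_unit_itv i j)%:E =
  (\int[lebesgue_measure]_(x in `[0%R, 1%R]) (coord_density i j x)%:E)%E.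
Proof.
have lfin : (lebesgue_measure (`[0%R, 1%R] : set (measurableTypeR R)) < +oo)%E.
  by rewrite lebesgue_measure_itv/= lte_fin ltr01 oppr0 adde0 ltry.
have fi := integrable_coord_density lebesgue_measure i j lfin.
(* Extending the density by 0 outside [0, 1] makes it nonnegative everywhere, as [integral_uniform]
   requires. *)
rewrite coord_weight_mxE /Rintegral integral_mkcond integral_uniform.
- rewrite subr0 invr1 mul1e.
  under eq_integral => x xI do rewrite patchE xI.
  by rewrite fineK// integrable_fin_num.
- apply/(measurable_restrictT _ _).1 => //.
  by apply/measurable_EFinP; exact: measurable_coord_density.
- move=> x; rewrite patchE; case: ifPn => //; rewrite inE => x01.
  by rewrite lee_fin; exact: coord_density_ge0.
Qed.

(** Each coordinate is a constant times n / z with n = 1 - x or n = x, and (n / z)' is a constant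
    times z^-2. Hence the density is the derivative of a multiple of (n / z)^3. The value does not
    depend on i, whence equal weights. *)
Lemma coord_weight_mx_uniform_unit_itv_diag i :
  coord_weight_mx uniform_unit_itv i i = (3 * b0 * (b0 + b1))^-1.
Proof.
have b0_neq0 := lt0r_neq0 b0_gt0; have b01_neq0 := lt0r_neq0 b01_gt0.
apply: EFin_inj; rewrite coord_weight_mx_uniform_unit_itv.
pose z := linpred b0 b1.
pose n x : R := if i == 0 then 1 - x else x.
pose c := if i == 0 then - (b0 ^+ 2 / (3 * (b0 + b1)))
          else (b0 + b1) ^+ 2 / (3 * b0).
pose F x := c * (n x / z x) ^+ 3.
have dF x : x \in `[0, 1] -> is_derive x 1 F (coord_density i i x).
  rewrite in_itv/= => x01.
  have zx_neq0 : z x != 0 by rewrite lt0r_neq0// linpred_gt0.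
  have dz : is_derive x 1 z b1.
    have -> : z = cst b0 + b1 \*: id by [].
    by apply: is_derive_eq; rewrite add0r scaler1.
  have dn : is_derive x 1 n (if i == 0 then -1 else 1).
    rewrite /n; case: (i == 0); last exact: is_derive_id.
    have -> : (fun y : R => 1 - y) = cst 1 - id by [].
    by apply: is_derive_eq; rewrite sub0r.
  have dV := is_deriveV zx_neq0 dz.
  (* Written with operations on functions so that the derivative is found by instance inference. *)
  have -> : F = c \*: ((n * (fun y => (z y)^-1)) ^+ 3) by [].
  apply: is_derive_eq; rewrite /c /n /coord_density /endpoint_coord.
  rewrite /endpoint_frac !fctE /GRing.scale/= /z /linpred.
  move: zx_neq0; rewrite /z /linpred => zx_neq0.
  by case: (i == 0); field; rewrite ?b0_neq0 ?b01_neq0 ?zx_neq0.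
rewrite (continuous_FTC2_derive _ (coord_density i i) F 0 1 (@ltr01 R)
  (within_continuous_coord_density i i) dF).
congr EFin; rewrite /F /c /n /z /linpred.
case: (i == 0); rewrite ?mulr0 ?mulr1 ?addr0;
  by field; rewrite ?b0_neq0 ?b01_neq0.
Qed.

End EndpointCoordinates.

(** * Existence and the three explicit optimal weights *)

Theorem proposition1 (R : realType) (kappa b0 b1 : R)
    (kappa_gt0 : 0 < kappa) (b0_gt0 : 0 < b0) (b01_gt0 : 0 < b0 + b1) :
  [/\ forall nu : {measure set (measurableTypeR R) -> \bar R},
        nu `[0, 1]%classic = 1%E ->
        exists xi : seq (R * R),
          supported_on_endpoints xi /\ IMSE_optimal kappa b0 b1 nu xi,
      (exists w : R, [/\ 1 - w = 1 / 2, w = 1 / 2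
        & IMSE_optimal kappa b0 b1 uniform_unit_itv (endpoint_design w)]),
      (exists w : R, [/\ 1 - w = (b0 + b1) / (2 * b0 + b1),
          w = b0 / (2 * b0 + b1)
        & IMSE_optimal kappa b0 b1 uniform_endpoints (endpoint_design w)])
    & (exists w : R, [/\ 1 - w = b0 / (2 * b0 + b1),
          w = (b0 + b1) / (2 * b0 + b1)
        & IMSE_optimal kappa b0 b1 dirac_midpoint (endpoint_design w)])].
Proof.
have z_gt0 : 0 < 2 * b0 + b1 by lra.
have z_neq0 := lt0r_neq0 z_gt0; have b0_neq0 := lt0r_neq0 b0_gt0.
have b01_neq0 := lt0r_neq0 b01_gt0.
have optimal := endpoint_design_optimal kappa b0 b1 kappa_gt0 b0_gt0 b01_gt0.
have I0 : (0 : R) \in `[0, 1]%R by rewrite in_itv/= lexx ler01.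
have I1 : (1 : R) \in `[0, 1]%R by rewrite in_itv/= lexx ler01.
have Ih : (2^-1 : R) \in `[0, 1]%R by rewrite in_itv/=; apply/andP; split; lra.
have coordE := endpoint_coordE b0 b1 b01_gt0.
split.
- move=> nu nu1.
  by apply: exists_endpoint_optimal => //; rewrite nu1 ltry.
- exists (1 / 2); split=> //; first by lra.
  apply: optimal; first exact: le_lt_trans (probability_le1 _ _) (ltry _).
    by apply/andP; split; lra.
  by rewrite !coord_weight_mx_uniform_unit_itv_diag//; field;
    rewrite ?b0_neq0 ?b01_neq0.
- exists (b0 / (2 * b0 + b1)); split=> //; first by field.
  apply: optimal.
  + by rewrite /uniform_endpoints/= /mscale/= /msum
      !big_ord_recl big_ord0/= !diracE !mem_set//= adde0 -EFinD -EFinM ltry.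
  + by rewrite divr_gt0//= ltr_pdivrMr// mul1r; lra.
  (* Here U has diagonal b0^-2 / 2 and (b0 + b1)^-2 / 2, so p : q = (b0 + b1) : b0. *)
  rewrite !coord_weight_mx_uniform_endpoints// /coord_density !coordE.
  by rewrite /linpred; field; rewrite ?z_neq0 ?b0_neq0 ?b01_neq0.
- exists ((b0 + b1) / (2 * b0 + b1)); split=> //; first by field.
  apply: optimal.
  + by rewrite /dirac_midpoint/= diracE mem_set//= ltry.
  + by rewrite divr_gt0//= ltr_pdivrMr// mul1r; lra.
  (* Here p : q = (1 - t) : t at x = 1/2, so w is the value t = (b0 + b1) / (2 b0 + b1). *)
  rewrite !coord_weight_mx_dirac_midpoint// /coord_density /endpoint_coord/=.
  rewrite /endpoint_frac /linpred.
  by field; rewrite ?z_neq0.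
Qed.
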